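(* Define \[ \Lambda_n(p_1,p_2,p_3)=\frac12\,\frac1{(n+1)!}\sum_{m=1}^{n+1}S_{n+1}^{(m)}\Bigl(\frac{2-\phi}4\Bigr)^m\sum_{k=0}^m\binom mk\Bigl(\frac1{P(2-\phi)}\Bigr)^kL(-2k,\chi_{2P}^{(1,1,1)}),\qquad \phi=\phi(p_1,p_2,p_3). \] Then the coefficients $\lambda_n$ of $\tau_\infty(\Sigma(p_1,p_2,p_3))=\sum_{n\ge0}\lambda_n(q-1)^n$ are $\lambda_n(\Sigma(p_1,p_2,p_3))=\Lambda_n(p_1,p_2,p_3)$ when $\frac1{p_1}+\frac1{p_2}+\frac1{p_3}<1$, and $\lambda_n(\Sigma(2,3,5))=\Lambda_n(2,3,5)+(-1)^{n+1}$.
   Context: $p_1,p_2,p_3$ pairwise coprime positive integers, $P=p_1p_2p_3$, $\phi=3-\frac1P+12(s(p_2p_3,p_1)+s(p_1p_3,p_2)+s(p_1p_2,p_3))$ with Dedekind sums $s(b,a)=\sum_{k=1}^{a-1}((k/a))((kb/a))$ ($((x))=x-\lfloor x\rfloor-\frac12$ for $x\notin\mathbb Z$, $0$ otherwise). $\chi_{2P}^{(1,1,1)}$: odd $2P$-periodic, $\chi(n)=1$ if $n\equiv P(1+\sum_j\varepsilon_j/p_j)\pmod{2P}$ with signs $\varepsilon_1\varepsilon_2\varepsilon_3=-1$, $-1$ if with product $1$, $0$ otherwise; $L(-2k,\chi)=-\frac{(2P)^{2k}}{2k+1}\sum_{j=1}^{2P}\chi(j)B_{2k+1}(\frac j{2P})$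 with Bernoulli polynomials $B_n$. $S_n^{(m)}$ are Stirling numbers of the first kind: $\prod_{j=0}^{n-1}(x-j)=\sum_mS_n^{(m)}x^m$. The formal power series $\tau_\infty$ in $q-1$ (with $\log q=\log(1+(q-1))$, $q^a=\exp(a\log q)$) is defined by: for $\sum1/p_j<1$, $q^{\phi/4-1/2}(q-1)\tau_\infty(\Sigma(p_1,p_2,p_3))=\frac12\sum_{k\ge0}\frac{L(-2k,\chi_{2P}^{(1,1,1)})}{k!}\bigl(\frac{\log q}{4P}\bigr)^k$; for the Poincaré sphere ($P=30$), $q^{121/120}(q-1)\tau_\infty(\Sigma(2,3,5))=q^{1/120}+\frac12\sum_{k\ge0}\frac{L(-2k,\chi_{60}^{(1,1,1)})}{k!}\bigl(\frac{\log q}{120}\bigr)^k$, where $\chi_{60}^{(1,1,1)}(n)=-1$ for $n\equiv1,11,19,29$, $+1$ for $n\equiv31,41,49,59\pmod{60}$, $0$ otherwise, and $L(-2k,\chi_{60}^{(1,1,1)})$ is given by the same Bernoulli formula with $2P=60$. *)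

(* Defs.v *)
From mathcomp Require Import all_boot all_order all_algebra.
Set Implicit Arguments. Unset Strict Implicit. Unset Printing Implicit Defensive.
Import Order.TTheory GRing.Theory Num.Theory.
Local Open Scope ring_scope.

(* ---------- formal power series in x = q - 1, as coefficient sequences ---------- *)
Definition fps := nat -> rat.
Definition fps_one : fps := fun n => (n == 0%N)%:R.
Definition fps_X : fps := fun n => (n == 1%N)%:R.             (* q - 1 *)
Definition fps_add (f g : fps) : fps := fun n => f n + g n.
Definition fps_scale (c : rat) (f : fps) : fps := fun n => c * f n.
Definition fps_mul (f g : fps) : fps :=
  fun n => \sum_(i < n.+1) f i * g (n - i)%N.
Definition fps_pow (f : fps) (k : nat) : fps := iter k (fps_mul f) fps_one.
Definition fps_logq : fps :=
  fun n => if n == 0%N then 0 else (-1) ^+ n.+1 / n%:R.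
(* exp(f) for f with zero constant term: sum_k f^k / k! (coefficient n only
   involves k <= n) *)
Definition fps_exp (f : fps) : fps :=
  fun n => \sum_(k < n.+1) fps_pow f k n / (k`!)%:R.
Definition fps_qpow (a : rat) : fps := fps_exp (fps_scale a fps_logq).
Definition fps_logseries (c : nat -> rat) (d : rat) : fps :=
  fun n => \sum_(k < n.+1) c k * fps_pow (fps_scale d^-1 fps_logq) k n.

Definition sawtooth (x : rat) : rat :=
  if x == (Num.floor x)%:~R then 0 else x - (Num.floor x)%:~R - 2^-1.
Definition dedekind_sum (b a : nat) : rat :=
  \sum_(1 <= k < a) sawtooth (k%:R / a%:R) * sawtooth ((k * b)%:R / a%:R).

Definition PP (p1 p2 p3 : nat) : nat := (p1 * p2 * p3)%N.

Definition phi (p1 p2 p3 : nat) : rat :=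
  3 - (PP p1 p2 p3)%:R^-1
  + 12 * (dedekind_sum (p2 * p3) p1 + dedekind_sum (p1 * p3) p2
          + dedekind_sum (p1 * p2) p3).

Definition sgnb (b : bool) : int := if b then 1 else -1.
(* residue P(1 + sum_j eps_j / p_j) = P + sum_j eps_j P/p_j *)
Definition chi_res (p1 p2 p3 : nat) (e : bool * bool * bool) : int :=
  let: (e1, e2, e3) := e in
  (PP p1 p2 p3)%:Z + sgnb e1 * (p2 * p3)%N%:Z + sgnb e2 * (p1 * p3)%N%:Z
  + sgnb e3 * (p1 * p2)%N%:Z.
Definition chi_prod (e : bool * bool * bool) : int :=
  let: (e1, e2, e3) := e in sgnb e1 * sgnb e2 * sgnb e3.
Definition chi (p1 p2 p3 : nat) (n : int) : rat :=
  let M := (2 * PP p1 p2 p3)%N%:Z in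
  if [exists e : bool * bool * bool,
        (chi_prod e == -1) && (n == chi_res p1 p2 p3 e %[mod M])%Z] then 1
  else if [exists e : bool * bool * bool,
        (chi_prod e == 1) && (n == chi_res p1 p2 p3 e %[mod M])%Z] then -1
  else 0.

(* ---------- Bernoulli numbers (B_1 = -1/2) and polynomials ---------- *)
Fixpoint bern_upto (n : nat) : seq rat :=
  match n with
  | 0 => [:: 1]
  | n'.+1 => let s := bern_upto n' in
      rcons s (- (n'.+2%:R)^-1 *
               \sum_(k < n'.+2) ('C(n'.+2, k))%:R * nth 0 s k)
  end.
Definition bernoulli (n : nat) : rat := nth 0 (bern_upto n) n.
Definition bernoulli_poly (n : nat) (x : rat) : rat :=
  \sum_(k < n.+1) ('C(n, k))%:R * bernoulli k * x ^+ (n - k).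

(* L(-2k, chi) = -(2P)^(2k)/(2k+1) sum_{j=1}^{2P} chi(j) B_{2k+1}(j/2P) *)
Definition Lneg (p1 p2 p3 : nat) (k : nat) : rat :=
  let N := (2 * PP p1 p2 p3)%N in
  - (N%:R ^+ (2 * k)) / (2 * k).+1%:R *
    \sum_(1 <= j < N.+1) chi p1 p2 p3 j%:Z * bernoulli_poly (2 * k).+1 (j%:R / N%:R).

Definition stirling1 (n m : nat) : rat :=
  (\prod_(j < n) ('X - (j%:R)%:P) : {poly rat})`_m.

Definition Lambda (p1 p2 p3 : nat) (n : nat) : rat :=
  let ph := phi p1 p2 p3 in
  let P := (PP p1 p2 p3)%:R : rat in
  2^-1 * ((n.+1)`!)%:R^-1 *
  \sum_(1 <= m < n.+2) stirling1 n.+1 m * ((2 - ph) / 4) ^+ m *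
     \sum_(k < m.+1) ('C(m, k))%:R * (P * (2 - ph))^-1 ^+ k * Lneg p1 p2 p3 k.

(* lam = coefficients of tau_infty(Sigma(p1,p2,p3)) in powers of (q-1):
   q^(phi/4 - 1/2) (q-1) tau = 1/2 sum_k L(-2k,chi)/k! (log q / 4P)^k *)
Definition tau_spec (p1 p2 p3 : nat) (lam : fps) : Prop :=
  fps_mul (fps_qpow (phi p1 p2 p3 / 4 - 2^-1)) (fps_mul fps_X lam) =
  fps_scale 2^-1
    (fps_logseries (fun k => Lneg p1 p2 p3 k / (k`!)%:R) (4 * (PP p1 p2 p3)%:R)).

Definition tau_spec_poincare (lam : fps) : Prop :=
  fps_mul (fps_qpow (121%:R / 120%:R)) (fps_mul fps_X lam) =
  fps_add (fps_qpow (120%:R)^-1)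
    (fps_scale 2^-1 (fps_logseries (fun k => Lneg 2 3 5 k / (k`!)%:R) 120%:R)).

(* Main.v *)
Require Import Defs.
From mathcomp Require Import all_boot all_order all_algebra.
From mathcomp Require Import ring lra zify.
From Stdlib Require Import FunctionalExtensionality.
Import Order.TTheory GRing.Theory Num.Theory.
Local Open Scope ring_scope.
Set Implicit Arguments. Unset Strict Implicit. Unset Printing Implicit Defensive.

(* Put b = (2 - phi)/4, so that tau is obtained by multiplying the L-series by
   q^b and dividing by q - 1. Every series involved is a power series in log q,
   and such series multiply like their coefficient sequences. The expansion
   (log q)^m / m! = sum_N S_N^(m) (q - 1)^N / N! then gives the coefficients of
   the product; the factors b^(m-k) (4P)^(-k) can be written as
   b^m (P (2 - phi))^(-k) because phi is never 2: P (phi - 2) is an integer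
   congruent to (p2 p3)^2 modulo p1, by the congruence
   12 p s(b, p) = b + 1/b (mod p). Division by q - 1 is possible because
   L(0, chi) = 0, the residues defining chi being distinct and lying in
   ]0, 2P[ when sum 1/p_j < 1. For (2, 3, 5) two of them leave this interval,
   so that L(0, chi) = -2, and the extra term q^(1/120 - 121/120) = q^(-1)
   contributes (-1)^(n+1). *)

(** * Ring laws for power series, by truncation to polynomials *)

Definition fps_trunc (N : nat) (f : fps) : {poly rat} := \poly_(i < N.+1) f i.

Lemma coef_trunc N f i : (i <= N)%N -> (fps_trunc N f)`_i = f i.
Proof. by move=> le_iN; rewrite coef_poly ltnS le_iN. Qed.

(** Coefficient n of a product involves only coefficients up to n, so identities between series
    reduce to identities in the ring [{poly rat}]. *)
Lemma coefM_low {p q : {poly rat}} {f g : fps} {n} :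
  (forall i, (i <= n)%N -> p`_i = f i) -> (forall i, (i <= n)%N -> q`_i = g i) ->
  (p * q)`_n = fps_mul f g n.
Proof.
move=> pf qg; rewrite coefM; apply: eq_bigr => i _.
by rewrite pf ?qg ?leq_subr // -ltnS.
Qed.

Lemma fps_mulE f g N n : (n <= N)%N ->
  fps_mul f g n = (fps_trunc N f * fps_trunc N g)`_n.
Proof.
by move=> nN; rewrite (@coefM_low _ _ f g) // => i /leq_trans/(_ nN)/coef_trunc ->.
Qed.

Lemma fps_mulC f g : fps_mul f g = fps_mul g f.
Proof.
by apply: functional_extensionality => n; rewrite !(@fps_mulE _ _ n n) // mulrC.
Qed.

Lemma fps_mulA f g h : fps_mul f (fps_mul g h) = fps_mul (fps_mul f g) h.
Proof.
apply: functional_extensionality => n.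
rewrite -(@coefM_low (fps_trunc n f) (fps_trunc n g * fps_trunc n h)); last first.
- by move=> i /fps_mulE ->.
- exact: coef_trunc.
rewrite mulrA (@coefM_low _ _ (fps_mul f g) h) //; last exact: coef_trunc.
by move=> i /fps_mulE ->.
Qed.

Lemma fps_mul1 f : fps_mul fps_one f = f.
Proof.
apply: functional_extensionality => n.
rewrite /fps_mul big_ord_recl /= big1 ?addr0 ?subn0 ?mul1r // => i _.
by rewrite mul0r.
Qed.

Lemma fps_mulDr f g h :
  fps_mul f (fps_add g h) = fps_add (fps_mul f g) (fps_mul f h).
Proof.
apply: functional_extensionality => n; rewrite /fps_mul /fps_add -big_split /=.
by apply: eq_bigr => i _; rewrite mulrDr.
Qed.

Lemma fps_scalel c f g : fps_mul (fps_scale c f) g = fps_scale c (fps_mul f g).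
Proof.
apply: functional_extensionality => n; rewrite /fps_mul /fps_scale mulr_sumr.
by apply: eq_bigr => i _; rewrite mulrA.
Qed.

Lemma fps_scaler c f g : fps_mul f (fps_scale c g) = fps_scale c (fps_mul f g).
Proof. by rewrite fps_mulC fps_scalel fps_mulC. Qed.

Lemma fps_mulX0 f : fps_mul fps_X f 0%N = 0.
Proof. by rewrite /fps_mul big_ord1 mul0r. Qed.

Lemma fps_mulXS f n : fps_mul fps_X f n.+1 = f n.
Proof.
rewrite /fps_mul big_ord_recl mul0r add0r big_ord_recl /= mul1r subn1 /=.
by rewrite big1 ?addr0 // => i _; rewrite mul0r.
Qed.

Lemma fps_powS f k : fps_pow f k.+1 = fps_mul f (fps_pow f k).
Proof. by []. Qed.

Lemma fps_pow_scale c f k : fps_pow (fps_scale c f) k = fps_scale (c ^+ k) (fps_pow f k).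
Proof.
elim: k => [|k IHk].
  by apply: functional_extensionality => n; rewrite /fps_scale mul1r.
rewrite !fps_powS IHk fps_scalel fps_scaler.
by apply: functional_extensionality => n; rewrite /fps_scale mulrA exprS.
Qed.

Lemma fps_powE f k N n : (n <= N)%N -> fps_pow f k n = (fps_trunc N f ^+ k)`_n.
Proof.
elim: k n => [|k IHk] n nN; first by rewrite expr0 coef1.
rewrite exprS fps_powS (@coefM_low _ _ f (fps_pow f k)) // => i /leq_trans/(_ nN) iN.
  by rewrite coef_trunc.
by rewrite -IHk.
Qed.

Lemma fps_pow_eq0 f k n : f 0%N = 0 -> (n < k)%N -> fps_pow f k n = 0.
Proof.
move=> f0; elim: k n => [//|k IHk] n ltnk.
rewrite fps_powS /fps_mul big_ord_recl f0 mul0r add0r big1 // => i _.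
by rewrite IHk ?mulr0 //= /bump; have := ltn_ord i; lia.
Qed.

(** * Substitution into power series; series in log q *)

(** The substitution c(f) for f without constant term: f^k then has order at least k, so the terms k
    > n do not reach coefficient n. *)
Definition fps_comp (c f : fps) : fps :=
  fun n => \sum_(k < n.+1) c k * fps_pow f k n.

Lemma coef_comp_low (p : {poly rat}) c f N n : f 0%N = 0 -> (n <= N)%N ->
  (forall i, (i <= N)%N -> p`_i = c i) -> (p \Po fps_trunc N f)`_n = fps_comp c f n.
Proof.
move=> f0 nN pc; rewrite comp_polyE coef_sum.
pose F i := p`_i * fps_pow f i n.
have FE i : (p`_i *: fps_trunc N f ^+ i)`_n = F i by rewrite /F coefZ (@fps_powE _ _ N).
rewrite [LHS](eq_bigr (fun i : 'I__ => F i)); last by move=> i _; rewrite FE.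
rewrite /fps_comp [RHS](eq_bigr (fun i : 'I__ => F i)); last first.
  by move=> i _; rewrite /F pc // (leq_trans _ nN) // -ltnS.
(* The two sums have different lengths; both are padded with zero terms up to [M]. *)
pose M := maxn (size p) n.+1.
have wide m : (m <= M)%N -> (forall i, (m <= i)%N -> F i = 0) ->
    \sum_(i < m) F i = \sum_(i < M) F i.
  move=> mM Fm; rewrite (big_ord_widen _ _ mM) big_mkcond /=.
  by apply: eq_bigr => i _; case: ltnP => // /Fm ->.
rewrite (wide (size p)) ?leq_maxl //; last by move=> i /(nth_default 0); rewrite /F => ->; rewrite mul0r.
rewrite -(wide n.+1) ?leq_maxr // => i ltni.
by rewrite /F fps_pow_eq0 ?mulr0.
Qed.

Lemma fps_compM c d f : f 0%N = 0 ->
  fps_mul (fps_comp c f) (fps_comp d f) = fps_comp (fps_mul c d) f.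
Proof.
move=> f0; apply: functional_extensionality => n.
rewrite -(@coefM_low (fps_trunc n c \Po fps_trunc n f) (fps_trunc n d \Po fps_trunc n f)).
- by rewrite -comp_polyM (@coef_comp_low _ (fps_mul c d)) // => i /fps_mulE ->.
- by move=> i le_in; rewrite (@coef_comp_low _ c) // => j; apply: coef_trunc.
- by move=> i le_in; rewrite (@coef_comp_low _ d) // => j; apply: coef_trunc.
Qed.

Lemma fps_comp_scale (c : fps) a f :
  (fun n => \sum_(k < n.+1) c k * fps_pow (fps_scale a f) k n)
  = fps_comp (fun k => c k * a ^+ k) f.
Proof.
apply: functional_extensionality => n; apply: eq_bigr => k _.
by rewrite fps_pow_scale /fps_scale mulrA.
Qed.

Definition exp_coef (a : rat) : fps := fun k => a ^+ k / k`!%:R.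

Lemma fact_neq0 n : n`!%:R != 0 :> rat.
Proof. by rewrite pnatr_eq0 -lt0n fact_gt0. Qed.

Lemma bin_fact_rat m k : (k <= m)%N ->
  'C(m, k)%:R = m`!%:R / (k`!%:R * (m - k)`!%:R) :> rat.
Proof.
move=> km; rewrite -(bin_fact km) !natrM mulfK //.
by rewrite mulf_neq0 ?fact_neq0.
Qed.

(** The binomial theorem, divided by n!. *)
Lemma exp_coefD a b : fps_mul (exp_coef a) (exp_coef b) = exp_coef (a + b).
Proof.
apply: functional_extensionality => n.
rewrite /exp_coef addrC exprDn mulr_suml; apply: eq_bigr => i _.
have le_in : (i <= n)%N by rewrite -ltnS.
rewrite -[_ * _ *+ _]mulr_natr bin_fact_rat //.
by field; rewrite !fact_neq0.
Qed.

Lemma fps_qpowE a : fps_qpow a = fps_comp (exp_coef a) fps_logq.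
Proof.
rewrite /fps_qpow /fps_exp.
transitivity (fps_comp (fun k => k`!%:R^-1 * a ^+ k) fps_logq).
  by rewrite -fps_comp_scale; apply: functional_extensionality => n;
     apply: eq_bigr => k _; rewrite mulrC.
by congr fps_comp; apply: functional_extensionality => k; rewrite mulrC.
Qed.

Lemma fps_logseriesE c d :
  fps_logseries c d = fps_comp (fun k => c k / d ^+ k) fps_logq.
Proof.
rewrite /fps_logseries fps_comp_scale; congr fps_comp.
by apply: functional_extensionality => k; rewrite exprVn.
Qed.

Lemma fps_qpowD a b : fps_mul (fps_qpow a) (fps_qpow b) = fps_qpow (a + b).
Proof. by rewrite !fps_qpowE fps_compM // exp_coefD. Qed.

Lemma fps_qpow0 : fps_qpow 0 = fps_one.
Proof.
rewrite fps_qpowE; apply: functional_extensionality => n.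
rewrite /fps_comp big_ord_recl big1 ?addr0 /exp_coef.
  by rewrite expr0 fact0 divr1 mul1r.
by move=> i _; rewrite /= exprS !mul0r.
Qed.

(** * Powers of log q and Stirling numbers *)

(* The derivation (1 + X) d/dX, which sends log(1 + X) to 1. *)
Definition fps_theta (f : fps) : fps := fun n => n.+1%:R * f n.+1 + n%:R * f n.

Lemma fps_thetaE f N n : (n < N)%N ->
  fps_theta f n = ((1 + 'X) * (fps_trunc N f)^`())`_n.
Proof.
move=> ltnN; rewrite mulrDl mul1r coefD coefXM !coef_deriv coef_trunc //.
rewrite /fps_theta !mulr_natl; congr (_ + _); case: n ltnN => [|n] ltnN /=.
  by rewrite mulr0n.
by rewrite coef_trunc // ltnW.
Qed.

(** The Leibniz rule, inherited from polynomials truncated at n + 1, because coefficient n of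
    [fps_theta] involves coefficient n + 1. *)
Lemma fps_thetaM f g :
  fps_theta (fps_mul f g) = fps_add (fps_mul (fps_theta f) g) (fps_mul f (fps_theta g)).
Proof.
apply: functional_extensionality => n.
have lt_le i : (i <= n)%N -> (i < n.+1)%N by [].
rewrite /fps_add.
have fE i : (i <= n)%N -> (fps_trunc n.+1 f)`_i = f i by move=> ?; rewrite coef_trunc // ltnW.
have gE i : (i <= n)%N -> (fps_trunc n.+1 g)`_i = g i by move=> ?; rewrite coef_trunc // ltnW.
have fE' i : (i <= n)%N -> ((1 + 'X) * (fps_trunc n.+1 f)^`())`_i = fps_theta f i
  by move=> ?; rewrite -fps_thetaE.
have gE' i : (i <= n)%N -> ((1 + 'X) * (fps_trunc n.+1 g)^`())`_i = fps_theta g i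
  by move=> ?; rewrite -fps_thetaE.
rewrite -(coefM_low fE' gE) -(coefM_low fE gE') -coefD.
rewrite /fps_theta !(@fps_mulE f g n.+1) //.
set p := fps_trunc _ f; set q := fps_trunc _ g.
have -> : (1 + 'X) * p^`() * q + p * ((1 + 'X) * q^`()) = (1 + 'X) * (p * q)^`().
  by rewrite derivM; ring.
rewrite mulrDl mul1r coefD coefXM !coef_deriv !mulr_natl; congr (_ + _).
by case: (n) => [|m]; rewrite /= ?mulr0n ?coef_deriv.
Qed.

Lemma fps_theta_logq : fps_theta fps_logq = fps_one.
Proof.
apply: functional_extensionality => -[|n]; rewrite /fps_theta /fps_logq /fps_one /=.
  by rewrite mul0r addr0 mulrC divfK // expr2 mulrNN mulr1.
rewrite mulrC divfK ?pnatr_eq0 // [X in _ + X]mulrC divfK ?pnatr_eq0 //.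
by rewrite [X in X + _]exprS mulN1r addNr.
Qed.

Lemma fps_theta_pow k :
  fps_theta (fps_pow fps_logq k.+1) = fps_scale k.+1%:R (fps_pow fps_logq k).
Proof.
elim: k => [|k IHk].
  rewrite fps_powS fps_mulC fps_mul1 fps_theta_logq.
  by apply: functional_extensionality => n; rewrite /fps_scale mul1r.
rewrite fps_powS fps_thetaM fps_theta_logq fps_mul1 IHk fps_scaler -fps_powS.
by apply: functional_extensionality => n; rewrite /fps_add /fps_scale -[k.+2%:R]nat1r mulrDl mul1r.
Qed.

Lemma stirling1S n k :
  stirling1 n.+1 k.+1 = stirling1 n k - n%:R * stirling1 n k.+1.
Proof.
by rewrite /stirling1 big_ord_recr /= mulrBr coefB coefMX coefMC /= [_ * n%:R]mulrC.
Qed.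

Lemma stirling1S0 n : stirling1 n.+1 0 = 0.
Proof.
rewrite /stirling1 big_ord_recl /= subr0 coefXM //.
Qed.

(* Both sides satisfy the recursion expressing (1 + X) d/dX (log^(k+1)) = (k+1) log^k. *)
Lemma fps_pow_logq k n : fps_pow fps_logq k n = k`!%:R * stirling1 n k / n`!%:R.
Proof.
elim: n k => [|n IHn] [|k].
- by rewrite /stirling1 big_ord0 coef1 /= divr1 mul1r.
- by rewrite fps_pow_eq0 // /stirling1 big_ord0 coef1 mulr0 mul0r.
- by rewrite stirling1S0 mulr0 mul0r.
have := congr1 (fun f : fps => f n) (fps_theta_pow k).
rewrite /fps_theta /fps_scale !IHn stirling1S factS [n.+1`!]factS !natrM => E.
have n1 : n.+1%:R != 0 :> rat by rewrite pnatr_eq0.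
(* [E] determines (n + 1) times the wanted coefficient plus n times the preceding one, which is
   known by induction; the goal is brought to that form. *)
apply: (mulfI n1); apply: (addIr (n%:R * (k.+1%:R * k`!%:R * stirling1 n k.+1 / n`!%:R))).
by rewrite E; field; rewrite fact_neq0 nat1r.
Qed.

(** Newton's binomial series: summing S_n^(k) a^k over k evaluates the falling factorial polynomial
    at a. *)
Lemma fps_qpow_coef a n : fps_qpow a n = (\prod_(j < n) (a - j%:R)) / n`!%:R.
Proof.
rewrite fps_qpowE /fps_comp.
have -> : \prod_(j < n) (a - j%:R) = (\prod_(j < n) ('X - (j%:R)%:P) : {poly rat}).[a].
  by rewrite horner_prod; apply: eq_bigr => j _; rewrite !hornerE.
have sz : (size (\prod_(j < n) ('X - (j%:R)%:P) : {poly rat})%R <= n.+1)%N.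
  by rewrite size_prod_XsubC /index_enum unlock -enumT size_enum_ord.
rewrite (horner_coef_wide _ sz) mulr_suml; apply: eq_bigr => k _.
rewrite fps_pow_logq /exp_coef /stirling1; field.
by rewrite !fact_neq0.
Qed.

Lemma fps_qpowN1 n : fps_qpow (-1) n = (-1) ^+ n.
Proof.
rewrite fps_qpow_coef.
suff -> : \prod_(j < n) (-1 - j%:R) = (-1) ^+ n * n`!%:R :> rat.
  by rewrite mulfK // fact_neq0.
elim: n => [|n IHn]; first by rewrite big_ord0 mul1r.
by rewrite big_ord_recr /= IHn factS exprS natrM -nat1r; ring.
Qed.

(** * Solving for tau and comparison with Lambda *)

(** The factor q^a has inverse q^(-a), and multiplication by q - 1 shifts coefficients. Existence of
    a solution thus amounts to a vanishing constant term, and the solution is unique. *)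
Lemma fps_qpow_divX a R lam :
  fps_mul (fps_qpow a) (fps_mul fps_X lam) = R <->
  fps_mul (fps_qpow (- a)) R 0%N = 0 /\
  (forall n, lam n = fps_mul (fps_qpow (- a)) R n.+1).
Proof.
have K b f : fps_mul (fps_qpow (- b)) (fps_mul (fps_qpow b) f) = f.
  by rewrite fps_mulA fps_qpowD addNr fps_qpow0 fps_mul1.
split=> [<-|[R0 RS]].
  by rewrite K fps_mulX0; split=> // n; rewrite fps_mulXS.
rewrite -[R in RHS](K (- a)) opprK; congr fps_mul.
apply: functional_extensionality => -[|n]; first by rewrite fps_mulX0 R0.
by rewrite fps_mulXS.
Qed.

(** The Cauchy product is taken in powers of log q; the m! in the expansion of (log q)^m turns 1/(k!
    (m - k)!) into a binomial coefficient. *)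
Lemma fps_qpow_logseries b c d N :
  fps_mul (fps_qpow b) (fps_logseries (fun k => c k / k`!%:R) d) N =
  N`!%:R^-1 * \sum_(m < N.+1) stirling1 N m *
    \sum_(k < m.+1) 'C(m, k)%:R * b ^+ (m - k) / d ^+ k * c k.
Proof.
rewrite fps_mulC fps_qpowE fps_logseriesE fps_compM // /fps_comp mulr_sumr.
apply: eq_bigr => m _; rewrite fps_pow_logq /fps_mul !mulr_suml !mulr_sumr.
apply: eq_bigr => k _; have km : (k <= m)%N by rewrite -ltnS.
rewrite bin_fact_rat // /exp_coef -exprVn; field.
by rewrite !fact_neq0.
Qed.

Lemma fps_qpow_logseries_Lambda p1 p2 p3 n :
  phi p1 p2 p3 != 2 -> PP p1 p2 p3 != 0%N ->
  fps_mul (fps_qpow (- (phi p1 p2 p3 / 4 - 2^-1)))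
    (fps_scale 2^-1 (fps_logseries (fun k => Lneg p1 p2 p3 k / (k`!)%:R)
       (4 * (PP p1 p2 p3)%:R))) n.+1
  = Lambda p1 p2 p3 n.
Proof.
move=> ph2 P0; rewrite fps_scaler /fps_scale fps_qpow_logseries.
have {}P0 : (PP p1 p2 p3)%:R != 0 :> rat by rewrite pnatr_eq0.
rewrite /Lambda; move: (phi _ _ _) ph2 (PP _ _ _)%:R P0 => ph ph2 P P0.
have {}ph2 : 2 - ph != 0 by rewrite subr_eq0 eq_sym.
rewrite mulrA; congr (_ * _).
(* The term m = 0 vanishes because S_(n+1)^(0) = 0; the sum in [Lambda] starts at m = 1. *)
rewrite big_ord_recl stirling1S0 mul0r add0r big_add1 /= big_mkord.
apply: eq_bigr => m _; rewrite /bump /= add1n.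
rewrite -mulrA; congr (_ * _); rewrite mulr_sumr; apply: eq_bigr => k _.
have km : (k <= m.+1)%N by rewrite -ltnS.
have -> : - (ph / 4 - 2^-1) = (2 - ph) / 4 by field.
set b := (2 - ph) / 4.
have b0 : b != 0 by rewrite mulf_neq0.
(* With this, b^(m+1) (P (2 - phi))^(-k) becomes b^(m+1-k) (4P)^(-k), which needs b to be
   nonzero. *)
have -> : P * (2 - ph) = 4 * P * b by rewrite /b; field.
clearbody b; have -> : b ^+ m.+1 = b ^+ (m.+1 - k) * b ^+ k by rewrite -exprD subnK.
by rewrite exprVn !exprMn; field; rewrite !expf_neq0.
Qed.

(** * Dedekind sums and phi != 2 *)

Lemma sawtooth_frac (a m : nat) : (0 < a)%N ->
  sawtooth (m%:R / a%:R) = if (a %| m)%N then 0 else (m %% a)%N%:R / a%:R - 2^-1.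
Proof.
move=> a0; have aR : 0 < a%:R :> rat by rewrite ltr0n.
have fl : Num.floor (m%:R / a%:R : rat) = (m %/ a)%N%:Z.
  apply: Num.Theory.floor_def; rewrite intrD -!pmulrn.
  rewrite ler_pdivlMr // ltr_pdivrMr // -natrM ler_nat leq_trunc_div /=.
  by rewrite natr1 -natrM ltr_nat ltn_ceil.
rewrite /sawtooth fl -pmulrn.
have E : m%:R / a%:R - (m %/ a)%N%:R = (m %% a)%N%:R / a%:R :> rat.
  by rewrite {1}(divn_eq m a) natrD natrM; field; rewrite gt_eqF.
rewrite -subr_eq0 E mulf_eq0 invr_eq0 (gt_eqF aR) orbF pnatr_eq0.
by rewrite /dvdn.
Qed.

Lemma sum_mulmod (V : zmodType) (a b : nat) (g : nat -> V) : coprime a b ->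
  \sum_(0 <= k < a) g ((k * b) %% a)%N = \sum_(0 <= k < a) g k.
Proof.
case: a => [|a] co; first by rewrite !big_geq.
rewrite !big_mkord.
pose h (i : 'I_a.+1) := Ordinal (ltn_pmod (i * b) (ltn0Sn a)).
have hi : injective h.
  move=> i j /(congr1 val) /= /eqP E; apply: val_inj => /=.
  (* For i <= j, a divides (j - i) b, hence j - i, which is less than a. *)
  wlog le_ij : i j E / (i <= j)%N.
    by case: (leqP i j) => [le | /ltnW le] H; [|symmetry]; apply: H => //; rewrite eq_sym.
  move: E; rewrite eq_sym eqn_mod_dvd ?leq_mul2r ?le_ij ?orbT // -mulnBl Gauss_dvdl //.
  move=> /dvdn_leq; have := ltn_ord j; have := ltn_ord i; lia.
by rewrite [RHS](reindex_inj hi).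
Qed.

Lemma sum_id_int (a : nat) : 2 * (\sum_(0 <= k < a) k%:Z) = a%:Z * (a%:Z - 1).
Proof.
elim: a => [|a IHa]; first by rewrite big_geq.
by rewrite big_nat_recr //= mulrDr IHa -[a.+1]addn1 PoszD; ring.
Qed.

Lemma sum_sqr_int (a : nat) :
  6 * (\sum_(0 <= k < a) k%:Z ^+ 2) = a%:Z * (a%:Z - 1) * (2 * a%:Z - 1).
Proof.
elim: a => [|a IHa]; first by rewrite big_geq.
by rewrite big_nat_recr //= mulrDr IHa -[a.+1]addn1 PoszD; ring.
Qed.

Lemma dedekind_sum_int a b : (0 < a)%N -> coprime a b ->
  12 * a%:R ^+ 2 * dedekind_sum b a =
  (12 * (\sum_(0 <= k < a) k%:Z * ((k * b) %% a)%N%:Z) - 3 * a%:Z ^+ 2 * (a%:Z - 1))%:~R.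
Proof.
move=> a0 co.
have aR : a%:R != 0 :> rat by rewrite pnatr_eq0 -lt0n.
pose r k := ((k * b) %% a)%N.
(* The sum is extended to k = 0, whose term (-1/2)^2 = 1/4 is subtracted again. For 0 < k < a
   neither k nor k b is divisible by a, so no sawtooth takes its exceptional value 0. *)
have E : dedekind_sum b a =
    \sum_(0 <= k < a) (k%:R / a%:R - 2^-1) * ((r k)%:R / a%:R - 2^-1) - 4^-1.
  rewrite /dedekind_sum [X in X - _]big_ltn // /r mod0n !mul0r.
  have -> : (0 - 2^-1) * (0 - 2^-1) = 4^-1 :> rat by field.
  rewrite addrAC subrr add0r; apply: eq_big_nat => k /andP [k0 ka].
  rewrite !sawtooth_frac // Gauss_dvdl // gtnNdvd // modn_small //.
have SR : \sum_(0 <= k < a) (r k)%:R = \sum_(0 <= k < a) k%:R :> rat.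
  exact: (@sum_mulmod _ a b (fun k => k%:R)).
have S1 : 2 * \sum_(0 <= k < a) k%:R = a%:R * (a%:R - 1) :> rat.
  have := congr1 (fun z : int => z%:~R : rat) (sum_id_int a).
  by rewrite !rmorphM rmorphB /= rmorph_sum.
have {}E : dedekind_sum b a =
    (\sum_(0 <= k < a) k%:R * (r k)%:R) / a%:R ^+ 2
    - (2 * \sum_(0 <= k < a) k%:R) / (2 * a%:R) + a%:R / 4 - 4^-1.
  rewrite E; congr (_ - _).
  have -> : a%:R / 4 = \sum_(0 <= k < a) 4^-1 :> rat.
    by rewrite sumr_const_nat subn0 -[RHS]mulr_natl.
  have -> : (2 * \sum_(0 <= k < a) k%:R) / (2 * a%:R) =
      (\sum_(0 <= k < a) k%:R + \sum_(0 <= k < a) (r k)%:R) / (2 * a%:R) :> rat.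
    by rewrite SR mulr_natl mulr2n.
  rewrite -big_split /= !mulr_suml -sumrB -big_split /=.
  by apply: eq_bigr => k _; field.
rewrite E S1 rmorphB !rmorphM rmorphB ?rmorphXn /= rmorph_sum /=.
rewrite [X in _ = _ * X - _](eq_bigr (fun k => k%:R * (r k)%:R)); last by move=> k _; rewrite intrM.
by field.
Qed.

(* 12 a s(b, a) is an integer congruent to b + 1/b modulo a. The cross term of
   the sum of (k b - r_k)^2, where r_k = k b mod a, gives 2 b (sum of k r_k)
   modulo a^2, because k -> r_k permutes the residues. *)
Lemma dedekind_sum_cong a b : (0 < a)%N -> coprime a b ->
  exists D e : int, 12 * a%:R * dedekind_sum b a = D%:~R
    /\ b%:Z * D = b%:Z ^+ 2 + 1 + a%:Z * e.
Proof.
move=> a0 co.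
have aR : a%:R != 0 :> rat by rewrite pnatr_eq0 -lt0n.
have aZ : a%:Z != 0 by rewrite eqz_nat -lt0n.
pose r k := ((k * b) %% a)%N.
pose F := \sum_(0 <= k < a) ((k * b) %/ a)%N%:Z ^+ 2.
have := dedekind_sum_int a0 co; set T := \sum_(_ <= k < _) _ => ET.
have S2 : \sum_(0 <= k < a) (r k)%:Z ^+ 2 = \sum_(0 <= k < a) k%:Z ^+ 2.
  exact: (@sum_mulmod _ a b (fun k => k%:Z ^+ 2)).
have bT : 2 * b%:Z * T = (b%:Z ^+ 2 + 1) * (\sum_(0 <= k < a) k%:Z ^+ 2) - a%:Z ^+ 2 * F.
  rewrite [X in _ = X - _]mulrDl mul1r -[X in _ + X - _]S2 /T /F !mulr_sumr -big_split -sumrB /=.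
  apply: eq_bigr => k _.
  have : k%:Z * b%:Z = ((k * b) %/ a)%N%:Z * a%:Z + (r k)%:Z.
    by rewrite -PoszM {1}(divn_eq (k * b) a) PoszD PoszM.
  rewrite -/(r k); set u := (_ %/ _)%N%:Z => H.
  transitivity ((k%:Z * b%:Z) ^+ 2 + (r k)%:Z ^+ 2 - (k%:Z * b%:Z - (r k)%:Z) ^+ 2); first by ring.
  by rewrite [in X in _ - X]H; ring.
have b12T : b%:Z * (12 * T) =
    a%:Z * ((b%:Z ^+ 2 + 1) * ((a%:Z - 1) * (2 * a%:Z - 1)) - 6 * a%:Z * F).
  transitivity (6 * (2 * b%:Z * T)); first by ring.
  rewrite bT mulrBr mulrCA sum_sqr_int; ring.
(* By [b12T], a divides b (12 T), and a is coprime to b. Hence 12 T / a is an integer, and so is 12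
   a s(b, a). *)
have : (a%:Z %| 12 * T)%Z.
  by rewrite -(@Gauss_dvdzr _ b%:Z) ?b12T ?dvdz_mulr.
case/dvdzP => t Et.
exists (t - 3 * a%:Z * (a%:Z - 1)).
(* This is [b12T] divided by a, with (a - 1)(2a - 1) = 1 + a (2a - 3) isolating b^2 + 1. *)
exists ((b%:Z ^+ 2 + 1) * (2 * a%:Z - 3) - 6 * F - 3 * b%:Z * (a%:Z - 1)).
split.
  apply: (mulfI aR); transitivity (12 * a%:R ^+ 2 * dedekind_sum b a); first by ring.
  rewrite ET Et -[a%:R]/(a%:Z%:~R) -rmorphM /=; congr (_%:~R); ring.
apply: (mulfI aZ).
have -> : a%:Z * (b%:Z * (t - 3 * a%:Z * (a%:Z - 1))) =
   b%:Z * (t * a%:Z) - 3 * a%:Z ^+ 2 * b%:Z * (a%:Z - 1) by ring.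
rewrite -Et b12T; ring.
Qed.

Lemma phi_neq2 p1 p2 p3 : (1 < p1)%N -> (0 < p2)%N -> (0 < p3)%N ->
  coprime p1 p2 -> coprime p1 p3 -> coprime p2 p3 -> phi p1 p2 p3 != 2.
Proof.
move=> p1_gt1 p2_gt0 p3_gt0 c12 c13 c23.
have p1_gt0 := ltnW p1_gt1.
have c1 : coprime p1 (p2 * p3) by rewrite coprimeMr c12.
have c2 : coprime p2 (p1 * p3) by rewrite coprimeMr coprime_sym c12.
have c3 : coprime p3 (p1 * p2) by rewrite coprimeMr !(coprime_sym p3) c13.
have [D1 [e1 [E1 F1]]] := dedekind_sum_cong p1_gt0 c1.
have [D2 [e2 [E2 _]]] := dedekind_sum_cong p2_gt0 c2.
have [D3 [e3 [E3 _]]] := dedekind_sum_cong p3_gt0 c3.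
apply/eqP => E.
have h1 : p1%:R != 0 :> rat by rewrite pnatr_eq0 -lt0n.
have h2 : p2%:R != 0 :> rat by rewrite pnatr_eq0 -lt0n.
have h3 : p3%:R != 0 :> rat by rewrite pnatr_eq0 -lt0n.
(* [Z] is P (phi - 2); it would vanish if phi = 2. Modulo p1 only -1 + p2 p3 [D1] survives, and this
   is (p2 p3)^2, so p1 > 1 would divide a number coprime to it. *)
pose Z : int := p1%:Z * p2%:Z * p3%:Z - 1 + p2%:Z * p3%:Z * D1
  + p1%:Z * p3%:Z * D2 + p1%:Z * p2%:Z * D3.
have Z0 : Z = 0.
  apply/eqP; rewrite -(intr_eq0 rat) /Z !(rmorphD, rmorphN, rmorphM) /= -E1 -E2 -E3.
  rewrite -!pmulrn.
  have := E; rewrite /phi /PP !natrM => {}E.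
  apply/eqP; transitivity (p1%:R * p2%:R * p3%:R * (2 - 2) : rat); last by ring.
  by rewrite -{1}E; field; rewrite h1 h2 h3.
have : (p1%:Z %| (p2 * p3)%N%:Z ^+ 2)%Z.
  apply/dvdzP; exists (- (p2%:Z * p3%:Z + e1 + p3%:Z * D2 + p2%:Z * D3)).
  have -> : (p2 * p3)%N%:Z ^+ 2 = (p2 * p3)%N%:Z * D1 - 1 - p1%:Z * e1 by rewrite F1; ring.
  rewrite PoszM -[LHS]subr0 -Z0 /Z; ring.
rewrite -rmorphXn /= dvdzE /= => dv.
have : coprime p1 ((p2 * p3) ^ 2) by rewrite coprimeXr.
by rewrite /coprime (gcdn_idPl dv) gtn_eqF.
Qed.

(** * The character chi and the value L(0, chi) *)

(** Half the difference of two residues is u p2 p3 + v p1 p3 + w p1 p2 with u, v, w in {-1, 0, 1},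
    and it is a multiple of P. Reduction modulo p1, p2, p3 in turn forces u = v = w = 0. *)
Lemma chi_res_inj p1 p2 p3 e f : (1 < p1)%N -> (1 < p2)%N -> (1 < p3)%N ->
  coprime p1 p2 -> coprime p1 p3 -> coprime p2 p3 ->
  (chi_res p1 p2 p3 e = chi_res p1 p2 p3 f %[mod (2 * PP p1 p2 p3)%N%:Z])%Z -> e = f.
Proof.
move=> h1 h2 h3 c12 c13 c23.
have c1 : coprime p1 (p2 * p3) by rewrite coprimeMr c12.
have c2 : coprime p2 (p1 * p3) by rewrite coprimeMr coprime_sym c12.
have c3 : coprime p3 (p1 * p2) by rewrite coprimeMr !(coprime_sym p3) c13.
(* Distinct signs differ by 2 or -2; cancelling the 2 on both sides makes p divide q, even when p =
   2. *)
have bit (p q : nat) (x y : bool) (t : int) : (1 < p)%N -> coprime p q ->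
    2 * (p%:Z * t) = (sgnb x - sgnb y) * q%:Z -> x = y.
  move=> p_gt1 co E; apply/eqP; apply: contraTT co => neq_xy.
  rewrite /coprime gtn_eqF //.
  suff /gcdn_idPl-> : (p %| q)%N by [].
  suff : (p%:Z %| q%:Z)%Z by [].
  case: x y E neq_xy => -[] //= E _; apply/dvdzP; [exists t|exists (- t)];
    rewrite /sgnb in E; lia.
move=> /eqP; rewrite eqz_mod_dvd => /dvdzP [t].
case: e f => [[x1 x2] x3] [[y1 y2] y3]; rewrite /chi_res /PP !PoszM => E.
have half x y : exists z, sgnb x - sgnb y = 2 * z :> int.
  by case: x y => -[]; [exists 0|exists 1|exists (-1)|exists 0].
have [u hu] := half x1 y1; have [v hv] := half x2 y2; have [w hw] := half x3 y3.
have {}E : 2 * u * (p2%:Z * p3%:Z) + 2 * v * (p1%:Z * p3%:Z) + 2 * w * (p1%:Z * p2%:Z)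
    = 2 * t * p1%:Z * p2%:Z * p3%:Z.
  rewrite -hu -hv -hw; transitivity (t * (2%:Z * (p1%:Z * p2%:Z * p3%:Z))); last by ring.
  by rewrite -E; ring.
congr (_, _, _).
- apply: (bit p1 _ _ _ (t * p2%:Z * p3%:Z - v * p3%:Z - w * p2%:Z) h1 c1).
  by rewrite hu PoszM; lra.
- apply: (bit p2 _ _ _ (t * p1%:Z * p3%:Z - u * p3%:Z - w * p1%:Z) h2 c2).
  by rewrite hv PoszM; lra.
- apply: (bit p3 _ _ _ (t * p1%:Z * p2%:Z - u * p2%:Z - v * p1%:Z) h3 c3).
  by rewrite hw PoszM; lra.
Qed.

Lemma chi_prodP e : chi_prod e = 1 \/ chi_prod e = -1.
Proof. by case: e => [[[] []] []]; [left|right|right|left|right|left|left|right]. Qed.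

(** At most one sign triple reaches n, so the two existence tests merge into one signed sum. The
    minus sign reflects that chi = 1 goes with sign product -1. *)
Lemma chiE p1 p2 p3 n : (1 < p1)%N -> (1 < p2)%N -> (1 < p3)%N ->
  coprime p1 p2 -> coprime p1 p3 -> coprime p2 p3 ->
  chi p1 p2 p3 n = \sum_(e : bool * bool * bool)
    (- chi_prod e)%:~R * (n == chi_res p1 p2 p3 e %[mod (2 * PP p1 p2 p3)%N%:Z])%Z%:R.
Proof.
move=> h1 h2 h3 c12 c13 c23; rewrite /chi.
have inj := chi_res_inj h1 h2 h3 c12 c13 c23.
set M := (2 * _)%N%:Z.
case: (pickP (fun e => (n == chi_res p1 p2 p3 e %[mod M])%Z)) => [e0 /eqP Ee0 | none].
  have uniq e : (n == chi_res p1 p2 p3 e %[mod M])%Z = (e == e0).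
    by apply/eqP/eqP => [Ee | -> //]; apply: inj; rewrite -Ee.
  rewrite (bigD1 e0) //= big1 ?addr0; last by move=> e /negPf; rewrite uniq => ->; rewrite mulr0.
  rewrite uniq eqxx mulr1.
  have ex c : [exists e, (chi_prod e == c) && (n == chi_res p1 p2 p3 e %[mod M])%Z]
      = (chi_prod e0 == c).
    apply/existsP/idP => [[e /andP [Ec]]|Ec]; first by rewrite uniq => /eqP <-.
    by exists e0; rewrite Ec uniq eqxx.
  by rewrite !ex; case: (chi_prodP e0) => ->.
rewrite big1; last by move=> e _; rewrite none mulr0.
by rewrite !ifF //; apply/existsP => -[e]; rewrite none andbF.
Qed.

Lemma sum_residue (N r : nat) (f : nat -> rat) : (0 < r <= N)%N ->
  \sum_(1 <= j < N.+1) (j%:Z == r%:Z %[mod N%:Z])%Z%:R * f j = f r.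
Proof.
move=> /andP [r0 rN].
rewrite (bigD1_seq r) ?iota_uniq ?mem_index_iota ?r0 //= eqxx mul1r.
rewrite big_nat_cond big1 ?addr0 // => j /andP [/andP [j0 jN] neq_jr].
rewrite eqz_mod_dvd (_ : (_ %| _)%Z = false) ?mul0r //.
apply/negbTE; apply: contra neq_jr => /dvdzP [t E]; apply/eqP.
(* Both j and r lie in [1, N], so |j - r| < N. *)
have t0 : t = 0 by nia.
by move: E; rewrite t0; lia.
Qed.

Lemma bernoulli_poly1 x : bernoulli_poly 1 x = x - 2^-1.
Proof.
rewrite /bernoulli_poly !big_ord_recl big_ord0 /bernoulli /= !big_ord_recl big_ord0 /=.
by rewrite /bump /= addn0 !add0n !bin0 binn subn0 subnn; field.
Qed.

(** L(0, chi) is minus the sum of chi(j) B_1(j/2P), with B_1(x) = x - 1/2. The map [r] selects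
    representatives in [1, 2P], since [chi_res] itself may leave this interval. *)
Lemma Lneg0 p1 p2 p3 (r : bool * bool * bool -> nat) :
  (1 < p1)%N -> (1 < p2)%N -> (1 < p3)%N ->
  coprime p1 p2 -> coprime p1 p3 -> coprime p2 p3 ->
  (forall e, (0 < r e <= 2 * PP p1 p2 p3)%N) ->
  (forall e, r e = chi_res p1 p2 p3 e %[mod (2 * PP p1 p2 p3)%N%:Z])%Z ->
  Lneg p1 p2 p3 0 =
  \sum_(e : bool * bool * bool) (chi_prod e)%:~R * ((r e)%:R / (2 * PP p1 p2 p3)%N%:R - 2^-1).
Proof.
move=> h1 h2 h3 c12 c13 c23 rN rE; rewrite /Lneg /= muln0 expr0 divr1 mulN1r.
set N := (2 * PP p1 p2 p3)%N in rN rE *.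
transitivity (- \sum_(1 <= j < N.+1) \sum_(e : bool * bool * bool)
    (- chi_prod e)%:~R * ((j%:Z == (r e)%:Z %[mod N%:Z])%Z%:R * (j%:R / N%:R - 2^-1)) : rat).
  congr (- _); apply: eq_bigr => j _; rewrite chiE // mulr_suml bernoulli_poly1.
  by apply: eq_bigr => e _; rewrite -/N rE mulrA.
rewrite exchange_big -sumrN; apply: eq_bigr => e _ /=.
rewrite -mulr_sumr (@sum_residue N (r e) (fun j => j%:R / N%:R - 2^-1)) //.
by rewrite rmorphN mulNr opprK.
Qed.

Lemma sum_signs (V : nmodType) (F : bool * bool * bool -> V) :
  \sum_e F e = F (true, true, true) + F (true, true, false)
   + F (true, false, true) + F (true, false, false) + F (false, true, true)
   + F (false, true, false) + F (false, false, true) + F (false, false, false).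
Proof.
transitivity (\sum_(a : bool) \sum_(b : bool) \sum_(c : bool) F (a, b, c)).
  rewrite !pair_bigA /=; apply: eq_bigr => -[[a b] c] //.
by rewrite !big_bool /= !addrA.
Qed.

Lemma Lneg0_hyperbolic p1 p2 p3 : (1 < p1)%N -> (1 < p2)%N -> (1 < p3)%N ->
  coprime p1 p2 -> coprime p1 p3 -> coprime p2 p3 ->
  (p2 * p3 + p1 * p3 + p1 * p2 < PP p1 p2 p3)%N -> Lneg p1 p2 p3 0 = 0.
Proof.
move=> h1 h2 h3 c12 c13 c23 lt.
(* The hypothesis says that P/p1 + P/p2 + P/p3 < P. *)
have res_bd e : 0 < chi_res p1 p2 p3 e < (2 * PP p1 p2 p3)%N%:Z.
  case: e => [[x1 x2] x3]; rewrite /chi_res; move: lt.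
  by case: x1 x2 x3 => -[] -[]; rewrite /sgnb; lia.
have abs_res e : `|chi_res p1 p2 p3 e|%N%:Z = chi_res p1 p2 p3 e.
  by rewrite gez0_abs // ltW //; case/andP: (res_bd e).
rewrite (Lneg0 (r := fun e => `|chi_res p1 p2 p3 e|%N)) //; last first.
- by move=> e; rewrite abs_res.
- by move=> e; have := res_bd e; lia.
have E e : `|chi_res p1 p2 p3 e|%N%:R = (chi_res p1 p2 p3 e)%:~R :> rat.
  by rewrite -[in RHS]abs_res.
(* The product of the three signs is summed against an affine function of them, which gives 0. *)
rewrite sum_signs !E /chi_res /chi_prod /sgnb !(rmorphD, rmorphM, rmorphN) /=.
by ring.
Qed.

(** The residues 61 and -1 are replaced by 1 and 59. Compared with the vanishing affine sum, each
    replacement contributes -1. *)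
Lemma Lneg0_poincare : Lneg 2 3 5 0 = -2.
Proof.
pose r (e : bool * bool * bool) : nat := match e with
  | (true, true, true) => 1 | (true, true, false) => 49
  | (true, false, true) => 41 | (true, false, false) => 29
  | (false, true, true) => 31 | (false, true, false) => 19
  | (false, false, true) => 11 | (false, false, false) => 59
  end%N.
rewrite (Lneg0 (r := r)) //; try by case=> [[[] []] []].
by rewrite sum_signs /r /chi_prod /sgnb /PP /=; field.
Qed.

(** * The exponent for (2, 3, 5) and the conclusion *)

(** With this value phi/4 - 1/2 = 121/120, the exponent in [tau_spec_poincare]. *)
Lemma phi_poincare : phi 2 3 5 = 181 / 30.
Proof.
rewrite /phi /dedekind_sum /PP.
have -> : index_iota 1 2 = [:: 1]%N by [].
have -> : index_iota 1 3 = [:: 1; 2]%N by [].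
have -> : index_iota 1 5 = [:: 1; 2; 3; 4]%N by [].
by rewrite !big_cons !big_nil !sawtooth_frac.
Qed.

Theorem mainTheorem6 :
  (forall p1 p2 p3 : nat,
     (0 < p1)%N -> (0 < p2)%N -> (0 < p3)%N ->
     coprime p1 p2 -> coprime p1 p3 -> coprime p2 p3 ->
     (p1%:R^-1 + p2%:R^-1 + p3%:R^-1 < 1 :> rat) ->
     tau_spec p1 p2 p3 (Lambda p1 p2 p3) /\
     (forall lam : fps, tau_spec p1 p2 p3 lam ->
        forall n : nat, lam n = Lambda p1 p2 p3 n)) /\
  (tau_spec_poincare (fun n => Lambda 2 3 5 n + (-1) ^+ n.+1) /\
   (forall lam : fps, tau_spec_poincare lam ->
      forall n : nat, lam n = Lambda 2 3 5 n + (-1) ^+ n.+1)).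
Proof.
have mul0 f g : fps_mul f g 0%N = f 0%N * g 0%N by rewrite /fps_mul big_ord1.
have qpow0 a : fps_qpow a 0%N = 1 by rewrite fps_qpow_coef big_ord0 divr1.
have log0 c d : fps_logseries c d 0%N = c 0%N.
  by rewrite /fps_logseries big_ord1 mulr1.
split.
  move=> p1 p2 p3 p1_gt0 p2_gt0 p3_gt0 c12 c13 c23 hyp.
  have i1 : 0 < p1%:R^-1 :> rat by rewrite invr_gt0 ltr0n.
  have i2 : 0 < p2%:R^-1 :> rat by rewrite invr_gt0 ltr0n.
  have i3 : 0 < p3%:R^-1 :> rat by rewrite invr_gt0 ltr0n.
  have gt1 p : (0 < p)%N -> p%:R^-1 < 1 :> rat -> (1 < p)%N.
    by move=> p0; rewrite invf_lt1 ?ltr0n // ltr1n.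
  (* The other two reciprocals are positive, so each one is below 1. *)
  have h1 : (1 < p1)%N by apply: gt1 => //; lra.
  have h2 : (1 < p2)%N by apply: gt1 => //; lra.
  have h3 : (1 < p3)%N by apply: gt1 => //; lra.
  have lt : (p2 * p3 + p1 * p3 + p1 * p2 < PP p1 p2 p3)%N.
    rewrite -(ltr_nat rat) !natrD !natrM.
    have P0 : 0 < p1%:R * p2%:R * p3%:R :> rat by rewrite !mulr_gt0 ?ltr0n.
    move: hyp; rewrite -(ltr_pM2l P0) mulr1.
    have -> : p1%:R * p2%:R * p3%:R * (p1%:R^-1 + p2%:R^-1 + p3%:R^-1)
      = p2%:R * p3%:R + p1%:R * p3%:R + p1%:R * p2%:R :> rat.
      by field; rewrite !pnatr_eq0 -!lt0n p1_gt0 p2_gt0 p3_gt0.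
    by [].
  have L0 := Lneg0_hyperbolic h1 h2 h3 c12 c13 c23 lt.
  have ph2 := phi_neq2 h1 p2_gt0 p3_gt0 c12 c13 c23.
  have P0 : PP p1 p2 p3 != 0%N by rewrite -lt0n !muln_gt0 p1_gt0 p2_gt0.
  have coefS n := fps_qpow_logseries_Lambda n ph2 P0.
  split=> [|lam /fps_qpow_divX [_ lamE] n]; last by rewrite lamE coefS.
  apply/fps_qpow_divX; split=> [|n]; last by rewrite coefS.
  by rewrite mul0 /fps_scale log0 L0 mul0r !mulr0.
have ph2 : phi 2 3 5 != 2 by apply: phi_neq2.
have P0 : PP 2 3 5 != 0%N by [].
set R := fps_add (fps_qpow 120%:R^-1)
  (fps_scale 2^-1 (fps_logseries (fun k => Lneg 2 3 5 k / k`!%:R) 120%:R)).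
(* The constant term is 1 + L(0, chi)/2 = 1 - 1: the added q^(1/120) makes division by q - 1
   possible. *)
have coef0 : fps_mul (fps_qpow (- (121%:R / 120%:R))) R 0%N = 0.
  by rewrite mul0 /R /fps_add /fps_scale !qpow0 log0 Lneg0_poincare /= fact0; field.
have coefS n : fps_mul (fps_qpow (- (121%:R / 120%:R))) R n.+1
    = Lambda 2 3 5 n + (-1) ^+ n.+1.
  rewrite /R fps_mulDr fps_qpowD /fps_add addrC.
  have -> : - (121%:R / 120%:R) + 120%:R^-1 = -1 :> rat by field.
  rewrite fps_qpowN1 -fps_qpow_logseries_Lambda // phi_poincare.
  have -> : 181 / 30 / 4 - 2^-1 = 121 / 120 :> rat by field.
  by have -> : 4 * (PP 2 3 5)%:R = 120 :> rat by rewrite -natrM.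
split=> [|lam /fps_qpow_divX [_ lamE] n]; last by rewrite lamE coefS.
by apply/fps_qpow_divX; split=> // n; rewrite coefS.
Qed.
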